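(* Let $a_1\ge 0$, $a_2\ge 0$ be real numbers with $a_1^2+a_2^2>0$, let $\mu$ be a probability measure on $(0,\infty)$, and let $\alpha$ be a random variable with distribution $\mu$. Assume that $0\neq \mathsf{E}\,|\ln\alpha| <\infty$ (so that $\mu$ is not concentrated at the point $\alpha=1$), and set $$K:=\int_0^\infty \ln\alpha\,\mu(\mathrm{d}\alpha)=\mathsf{E}[\ln\alpha].$$ If $K\le 0$, then any bounded solution $y$ on $\mathbb{R}$ of the equation $$-a_2\,y''(x)+a_1\,y'(x)+y(x)=\int_0^\infty y(\alpha x)\,\mu(\mathrm{d}\alpha),\qquad x\in\mathbb{R},$$ is trivial, i.e., $y(x)\equiv \mathrm{const}$, $x\in\mathbb{R}$.
   Context: A bounded solution is a function $y:\mathbb{R}\to\mathbb{R}$ with $\sup_{x\in\mathbb{R}}|y(x)|<\infty$ that is twice differentiable on $\mathbb{R}$ (only once differentiable if $a_2=0$, in which case the $y''$ term is absent) and satisfies the equation at every $x\in\mathbb{R}$. *)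

(* Defs.v *)
From HB Require Import structures.
From mathcomp Require Export all_boot all_order all_algebra.
From mathcomp Require Export all_classical all_reals all_analysis.
Export Order.TTheory GRing.Theory Num.Theory.
Export numFieldNormedType.Exports.

Set Implicit Arguments.
Unset Strict Implicit.
Unset Printing Implicit Defensive.

Local Open Scope classical_set_scope.
Local Open Scope ring_scope.

(* A probability measure on (0, +oo) is represented by a Borel probability
   measure on R giving mass 1 to ]0, +oo[. *)

(* When a2 = 0, y may fail to be twice differentiable; the junk value of the
   total operator y^`(2) is then multiplied by 0, so the second-order term is
   absent. The integral is compared in \bar R. *)
Definition pantograph_solution (R : realType) (a1 a2 : R)
    (mu : probability (measurableTypeR R) R) (y : R -> R) : Prop :=
  [/\ forall x : R, derivable y x 1,
      a2 != 0 -> forall x : R, derivable (y^`())%classic x 1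
    & forall x : R, (- a2 * (y^`(2))%classic x + a1 * (y^`())%classic x + y x)%:E
        = (\int[mu]_(a in `]0%R, +oo[) (y (a * x))%:E)%E].

Definition bounded_solution (R : realType) (a1 a2 : R)
    (mu : probability (measurableTypeR R) R) (y : R -> R) : Prop :=
  bounded_fun y /\ pantograph_solution a1 a2 mu y.

(* Main.v *)
(* Let osc h be the supremum of |y (x + k) - y x| over all x and |k| <= h.
   The increment u = y (. + k) - y solves the same equation with right-hand side
   E[y (alpha x + alpha k) - y (alpha x)], so the maximum principle for
   - a2 u'' + a1 u' + u on the line gives osc h <= E[osc (alpha h)]. Hence
   G t = osc (e^t) is a bounded nondecreasing function tending to 0 at -oo with
   G t <= E[G (t + Z)], where Z = ln alpha has mean K <= 0.

   Let F = G^2, let H be a primitive of F and Phi t = E[H (t + Z) - H t].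
   Then Phi' t = E[F (t + Z) - F t] >= E[(G (t + Z) - G t)^2] >= 0, while
   Phi tends to 0 at -oo and to F(+oo) K <= 0 at +oo. Hence Phi = 0, so
   G (t + Z) = G t almost surely; as Z < 0 with positive probability, G has a
   negative period and therefore vanishes. *)
Require Import Defs.
From mathcomp Require Import measurable_realfun ring lra.

Set Implicit Arguments.
Unset Strict Implicit.
Unset Printing Implicit Defensive.

Local Open Scope classical_set_scope.
Local Open Scope ring_scope.

(** * Tests at a maximum, the maximum principle and the derivative bound *)

Lemma is_derive1_continuous (R : realType) (f df : R -> R) :
  (forall x : R, is_derive x 1 f (df x)) -> continuous f.
Proof.
by move=> fd x; apply/differentiable_continuous/derivable1_diffP; case: (fd x).
Qed.

Lemma is_derive1_MVT (R : realType) (f df : R -> R) (a b : R) :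
  (forall x : R, is_derive x 1 f (df x)) -> a < b ->
  exists2 c, a < c < b & f b - f a = df c * (b - a).
Proof.
move=> fd ab.
have [|c cab ->] := MVT ab (fun x _ => fd x); last by exists c.
by apply: continuous_subspaceT; exact: is_derive1_continuous fd.
Qed.

Lemma is_derive_at_max (R : realType) (f df : R -> R) (c : R) :
  (forall x : R, is_derive x 1 f (df x)) -> (forall x, f x <= f c) -> df c = 0.
Proof.
move=> fd fc.
have fc0 : is_derive c 1 f 0.
  apply: (@derive1_at_max _ f (c - 1) (c + 1)).
  - lra.
  - by move=> t _; case: (fd t).
  - by rewrite in_itv/=; lra.
  - by move=> t _; exact: fc.
by have [_ <-] := fd c; have [_ <-] := fc0.
Qed.

(** Since [df c = 0], a positive [l] would make [df] positive just to the right of [c], and the mean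
    value theorem would give a value of [f] above [f c]. *)
Lemma second_derivative_at_max (R : realType) (f df : R -> R) (c l : R) :
  (forall x : R, is_derive x 1 f (df x)) -> (forall x, f x <= f c) ->
  is_derive c 1 df l -> l <= 0.
Proof.
move=> fd fc [dfd dfl]; rewrite leNgt; apply/negP => l0.
have dfc := is_derive_at_max fd fc.
have [e /= e0 He] : \forall h \near 0^', 0 < h^-1 *: (df (h *: 1 + c) - df c).
  apply: (@cvgr_gt _ _ _ _ _ l) => //.
  by rewrite -dfl; exact: dfd.
have [d /andP[d0 de] fE] : exists2 d, c < d < c + e / 2 &
    f (c + e / 2) - f c = df d * (c + e / 2 - c).
  by apply: is_derive1_MVT => //; lra.
have := He (d - c).
rewrite /ball/= sub0r normrN gtr0_norm; last lra.
rewrite dfc subr0 /GRing.scale/= mulr1 subrK => /(_ _ _)/wrap[]; [lra|lra|].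
rewrite pmulr_rgt0 ?invr_gt0; last lra.
move=> dfd0; have := fc (c + e / 2).
have : 0 < df d * (c + e / 2 - c) by apply: mulr_gt0 => //; lra.
lra.
Qed.

(** A bounded [u] need not attain its supremum, so [e * x ^+ 2] is subtracted; the first and second
    derivative tests at the maximum then bound [u] up to an error that vanishes with [e]. *)
Lemma maximum_principle (R : realType) (a1 a2 B M : R) (u u1 u2 : R -> R) :
  0 <= a1 -> 0 <= a2 -> (forall x : R, is_derive x 1 u (u1 x)) ->
  (a2 != 0 -> forall x : R, is_derive x 1 u1 (u2 x)) -> (forall x, u x <= B) ->
  (forall x, - a2 * u2 x + a1 * u1 x + u x <= M) -> forall x, u x <= M.
Proof.
move=> a10 a20 ud u1d uB uM x.
(* At the maximum [c] of the perturbed function the tests give an error [e] times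
   [x^2 - c^2 - 2 a1 c + 2 a2]; completing the square turns [- c^2 - 2 a1 c] into at most [a1^2]. *)
suff H (e : R) : 0 < e -> u x <= M + e * (x ^+ 2 + 2 * a2 + a1 ^+ 2).
  apply/ler_addgt0Pr => e e0.
  set q := x ^+ 2 + 2 * a2 + a1 ^+ 2 in H.
  have q0 : 0 <= q by rewrite !addr_ge0 ?sqr_ge0 ?mulr_ge0.
  apply: (le_trans (H (e / (q + 1)) _)); first by rewrite divr_gt0//; lra.
  rewrite lerD2l mulrAC ler_pdivrMr; last lra.
  by rewrite ler_pM2l//; lra.
move=> e0.
(* Unlike [u], the perturbation [v] attains its maximum. *)
pose v x := u x - e * x ^+ 2.
have vd (z : R) : is_derive z 1 v (u1 z - 2 * e * z).
  have := ud z => ?; apply: is_derive_eq.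
  by rewrite /GRing.scale/=; ring.
(* Outside [[-A, A]] one has [z^2 >= A], as [A >= 1], so [e z^2] exceeds [B - u 0] and [v z < v 0].
   The maximum over the interval is therefore global. *)
pose A := (B - u 0) / e + 1.
have A1 : 1 <= A.
  by rewrite /A lerDr divr_ge0 ?subr_ge0// ltW.
have [c cA cmax] : exists2 c, c \in `[- A, A] &
    forall t, t \in `[- A, A] -> v t <= v c.
  apply: EVT_max; first lra.
  by apply: continuous_subspaceT; exact: is_derive1_continuous vd.
have vc z : v z <= v c.
  have [zA|zA] := boolP (z \in `[- A, A]); first exact: cmax.
  apply: (@le_trans _ _ (v 0)); last by apply: cmax; rewrite in_itv/=; lra.
  have zA2 : A <= z ^+ 2.
    have [zA1|zA1] : z < - A \/ A < z.
      move: zA; rewrite in_itv/= negb_and -!ltNge => /orP[]; tauto.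
    - nra.
    - nra.
  rewrite /v expr0n/= mulr0 subr0.
  have : e * A <= e * z ^+ 2 by rewrite ler_pM2l.
  have -> : e * A = B - u 0 + e by rewrite /A; field; rewrite gt_eqF.
  have := uB z; lra.
have u1c := is_derive_at_max vd vc.
(* For [a2 = 0] nothing is known about [u2], so only the product is bounded. *)
have u2c : a2 * u2 c <= a2 * (2 * e).
  have [->|a2N0] := eqVneq a2 0; first by rewrite !mul0r.
  apply: ler_wpM2l => //.
  suff : u2 c - 2 * e <= 0 by lra.
  apply: (second_derivative_at_max vd vc).
  have := u1d a2N0 c => ?; apply: is_derive_eq.
  by rewrite /GRing.scale/=; ring.
have := vc x; have := uM c; rewrite /v.
have -> : u1 c = 2 * e * c by lra.
move=> H1 H2.
have : 0 <= e * (c + a1) ^+ 2 by rewrite mulr_ge0 ?sqr_ge0// ltW.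
nra.
Qed.

(** This supplies the Lipschitz constant of [y], which makes its oscillation continuous and small at
    small scales. If [a2 = 0] then [a1 > 0], and the bound is read off from the equation. *)
Lemma bounded_derivative (R : realType) (a1 a2 M : R) (y y1 y2 : R -> R) :
  0 <= a1 -> 0 <= a2 -> 0 < a1 ^+ 2 + a2 ^+ 2 ->
  (forall x : R, is_derive x 1 y (y1 x)) ->
  (a2 != 0 -> forall x : R, is_derive x 1 y1 (y2 x)) ->
  (forall x, `|y x| <= M) ->
  (forall x, `|- a2 * y2 x + a1 * y1 x + y x| <= M) ->
  exists L, forall x, `|y1 x| <= L.
Proof.
move=> a10 a20 a120 yd y1d yM eM.
have [a2E|a2N0] := eqVneq a2 0.
  have a1_gt0 : 0 < a1.
    by rewrite lt_neqAle a10 andbT eq_sym; apply: contraTneq a120 => ->;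
      rewrite a2E !expr0n/= addr0 ltxx.
  exists (2 * M / a1) => x; rewrite ler_pdivlMr//.
  have := eM x; have := yM x; rewrite a2E oppr0 mul0r add0r.
  have -> : `|y1 x| * a1 = `|a1 * y1 x| by rewrite normrM gtr0_norm// mulrC.
  by rewrite !ler_norml; lra.
have a2_gt0 : 0 < a2 by rewrite lt_neqAle a20 andbT eq_sym.
(* [z = y' - (a1 / a2) y] has a bounded derivative, and the mean value theorem
   gives a point of [x, x + 1] where [y'], hence [z], is bounded. *)
pose c := a1 / a2; pose z x := y1 x - c * y x.
have c0 : 0 <= c by rewrite divr_ge0.
have zd (x : R) : is_derive x 1 z (y2 x - c * y1 x).
  have := y1d a2N0 x => ?; have := yd x => ?; apply: is_derive_eq.
  by rewrite /GRing.scale/=; ring.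
have z'M x : `|y2 x - c * y1 x| <= 2 * M / a2.
  have -> : y2 x - c * y1 x = (a2 * y2 x - a1 * y1 x) / a2.
    by rewrite /c; field.
  rewrite normrM normfV (gtr0_norm a2_gt0) ler_pM2r ?invr_gt0//.
  by have := eM x; have := yM x; rewrite !ler_norml; lra.
exists (2 * M + 2 * c * M + 2 * M / a2) => x.
have [|p /andP[xp px] py] := @is_derive1_MVT _ y y1 x (x + 1) yd; first lra.
have [q _ qz] := is_derive1_MVT zd xp.
have y1p : `|y1 p| <= 2 * M.
  have -> : y1 p = y (x + 1) - y x by rewrite py; ring.
  by have := yM x; have := yM (x + 1); rewrite !ler_norml; lra.
have zpx : `|z p - z x| <= 2 * M / a2.
  rewrite qz normrM (@gtr0_norm _ (p - x)); last lra.
  rewrite -[leRHS]mulr1; apply: ler_pM => //; first lra.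
  lra.
have -> : y1 x = y1 p - c * y p + c * y x - (z p - z x) by rewrite /z; ring.
have cyM t : `|c * y t| <= c * M by rewrite normrM ger0_norm// ler_wpM2l.
have := cyM x; have := cyM p; move: y1p zpx; rewrite !ler_norml; lra.
Qed.

(** * Primitives of continuous functions and their increments *)

Lemma continuous_Rintegral_is_derive (R : realType) (f : R -> R) (a x : R) :
  continuous f -> a < x ->
  is_derive x 1 (fun t => \int[lebesgue_measure]_(s in `[a, t]) f s) (f x).
Proof.
move=> cf ax.
have [||||d e] := @continuous_FTC1_closed R f a x (x + 1).
- lra.
- apply: continuous_compact_integrable; first exact: segment_compact.
  exact: continuous_subspaceT.
- exact: ax.
- exact: cf.
- by apply: DeriveDef => //; rewrite -derive1E.
Qed.

(** The integral from [-1] is a primitive only to the right of [-1]. The reflected integral [K] is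
    one to the left of [1], and the two are glued at [0]. *)
Lemma continuous_primitive (R : realType) (f : R -> R) : continuous f ->
  exists F : R -> R, forall x : R, is_derive x 1 F (f x).
Proof.
move=> cf.
pose J t := \int[lebesgue_measure]_(s in `[-1 : R, t]) f s.
pose K t := \int[lebesgue_measure]_(s in `[-1 : R, - t]) (- f (- s)).
have dJ (x : R) : -1 < x -> is_derive x 1 J (f x).
  by move=> x1; exact: continuous_Rintegral_is_derive.
have dK (x : R) : x < 1 -> is_derive x 1 K (f x).
  move=> x1.
  have dK' : is_derive (- x) 1
      (fun t => \int[lebesgue_measure]_(s in `[-1 : R, t]) (- f (- s)))
      (- f (- - x)).
    apply: (@continuous_Rintegral_is_derive _ (fun s => - f (- s))); last lra.
    move=> s; apply: cvgN; apply: continuous_comp; last exact: cf.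
    exact: opp_continuous.
  have dN : is_derive x 1 (fun t : R => - t) (- 1) by apply: is_derive_eq.
  have := is_derive1_comp dK' dN.
  rewrite opprK /GRing.scale/= mulrN1 opprK; exact.
(* Both pieces are primitives of [f] on []-1, 1[], so this constant makes them agree there, and near
   [0] the glued function is just [J]. *)
pose F t := if t < 0 then K t + (J 0 - K 0) else J t.
have FJ t : -1 < t -> F t = J t.
  rewrite /F; case: ifPn => // t0 t1.
  have [||c _] := @MVT _ (fun x => J x - K x) (fun=> 0) t 0 t0.
  - move=> x; rewrite in_itv/= => x01.
    have ? : is_derive x 1 J (f x) by apply: dJ; lra.
    have ? : is_derive x 1 K (f x) by apply: dK; lra.
    by rewrite -(subrr (f x)); exact: is_deriveB.
  - apply: derivable_within_continuous => x; rewrite in_itv/= => x01.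
    have [? _] : is_derive x 1 J (f x) by apply: dJ; lra.
    have [? _] : is_derive x 1 K (f x) by apply: dK; lra.
    exact: derivableB.
  rewrite mul0r; lra.
exists F => x; have [x0|x0] := ltP x 0.
  apply: (@near_eq_is_derive _ _ _ (fun t => K t + (J 0 - K 0))).
    near=> t; rewrite /F ifT//.
    by near: t; exact: lt_nbhsl.
  have ? : is_derive x 1 K (f x) by apply: dK; lra.
  by apply: is_derive_eq; rewrite addr0.
apply: (@near_eq_is_derive _ _ _ J).
  near=> t; rewrite FJ//.
  by near: t; apply: lt_nbhsr; lra.
by apply: dJ; lra.
Unshelve. all: end_near. Qed.

Lemma is_derive_increment (R : realType) (f df : R -> R) (k x : R) :
  (forall x : R, is_derive x 1 f (df x)) ->
  is_derive x 1 (fun t => f (t + k) - f t) (df (x + k) - df x).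
Proof.
move=> fd.
have dk : is_derive x 1 (fun t : R => t + k) 1.
  by apply: is_derive_eq; rewrite addr0.
have := @is_derive1_comp R f _ x _ _ (fd (x + k)) dk.
by rewrite /GRing.scale/= mulr1 => dfk; exact: (is_deriveB dfk (fd x)).
Qed.

(** The mean value theorem for either sign of [z]. The intermediate point is written [c + t] so that
    the bound on [c] is independent of [t]. *)
Lemma primitive_increment (R : realType) (F H : R -> R) (t z : R) :
  (forall x : R, is_derive x 1 H (F x)) ->
  exists2 c, `|c| <= `|z| & H (t + z) - H t = F (c + t) * z.
Proof.
move=> dH; have [z0|z0|->] := ltgtP z 0.
- have [|c tc E] := @is_derive1_MVT _ H F (t + z) t dH; first lra.
  exists (c - t); first by rewrite !ltr0_norm; lra.
  rewrite subrK; lra.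
- have [|c tc E] := @is_derive1_MVT _ H F t (t + z) dH; first lra.
  exists (c - t); first by rewrite !gtr0_norm; lra.
  rewrite subrK; lra.
- by exists 0 => //; rewrite addr0 mulr0 subrr.
Qed.

(** * Mean increments of a primitive under the random step [Z] *)

Section random_walk.
Context (R : realType) (d : measure_display) (T : measurableType d)
  (mu : {measure set T -> \bar R}) (D : set T) (Z : T -> R).
Hypotheses (mD : measurable D) (muD : mu D = 1%E).
Hypothesis iZ : mu.-integrable D (EFin \o Z).

Lemma measurable_comp_increment (H : R -> R) (t : R) : continuous H ->
  measurable_fun D (fun x => H (t + Z x)).
Proof.
move=> cH.
have mZ : measurable_fun D Z by apply/measurable_EFinP/(measurable_int mu).
apply: (@measurableT_comp _ _ _ _ _ _ H).
  exact: continuous_measurable_fun.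
by apply: measurable_funD => //; exact: measurable_cst.
Qed.

Lemma integrable_bounded (f : T -> R) (C : R) :
  measurable_fun D f -> (forall x, D x -> `|f x| <= C) ->
  mu.-integrable D (EFin \o f).
Proof.
move=> mf fC; apply: measurable_bounded_integrable => //.
  by rewrite muD ltry.
by exists C; split; [exact: num_real | move=> M CM x Dx /=;
  rewrite (le_trans (fC _ Dx))// ltW].
Qed.

Section increment.
Context (F H : R -> R) (C : R).
Hypothesis dH : forall x : R, is_derive x 1 H (F x).
Hypothesis F0C : forall x, 0 <= F x <= C.

Lemma increment_bound (t z : R) : `|H (t + z) - H t| <= C * `|z|.
Proof.
have [c _ ->] := primitive_increment t z dH.
rewrite normrM ler_wpM2r//; have /andP[F0 FC] := F0C (c + t).
by rewrite ger0_norm.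
Qed.

Lemma measurable_increment (t : R) :
  measurable_fun D (fun x => H (t + Z x) - H t).
Proof.
apply: measurable_funB; last exact: measurable_cst.
by apply: measurable_comp_increment; exact: is_derive1_continuous dH.
Qed.

Lemma integrable_CZ : mu.-integrable D (fun x => (C * `|Z x|)%:E).
Proof.
under eq_fun do rewrite EFinM.
apply: integrableZl => //.
exact: (integrable_abse iZ).
Qed.

Lemma integrable_increment (t : R) :
  mu.-integrable D (EFin \o (fun x => H (t + Z x) - H t)).
Proof.
apply: le_integrable integrable_CZ => //.
  by apply/measurable_EFinP; exact: measurable_increment.
move=> x Dx /=; rewrite lee_fin (le_trans (increment_bound _ _))//.
exact: ler_norm.
Qed.

Hypothesis ndF : {homo F : s t / s <= t}.

(** Dominated convergence with dominating function [C * |Z|]. Used with [t n = n] and [t n = - n],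
    it gives the limits of the mean increment at both ends of the line. *)
Lemma cvg_integral_increment (t : nat -> R) (l : R) :
  (forall c, F (c + t n) @[n --> \oo] --> l) ->
  \int[mu]_(x in D) (H (t n + Z x) - H (t n)) @[n --> \oo] -->
  l * \int[mu]_(x in D) Z x.
Proof.
move=> Fl; rewrite -RintegralZl//.
have [|||||_ _] := @dominated_convergence _ _ _ mu D mD
  (fun n x => (H (t n + Z x) - H (t n))%:E) (fun x => (l * Z x)%:E)
  (fun x => (C * `|Z x|)%:E).
- by move=> n; apply/measurable_EFinP; exact: measurable_increment.
- apply/measurable_EFinP; apply: measurable_funM; first exact: measurable_cst.
  by apply/measurable_EFinP/(measurable_int mu).
- apply: aeW => x Dx; apply: cvg_EFin; first exact: nearW.
  apply/subr_cvg0; apply: norm_cvg0.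
  (* The intermediate offset varies with [n], whereas [Fl] treats fixed offsets; monotonicity of [F]
     squeezes it between the offsets [- |Z x|] and [|Z x|]. *)
  have lim0 : (`|F (- `|Z x| + t n) - l| + `|F (`|Z x| + t n) - l|) * `|Z x|
      @[n --> \oo] --> (0 : R).
    have n0 c : `|F (c + t n) - l| @[n --> \oo] --> (0 : R).
      by rewrite -(@normr0 _ R); apply: cvg_norm; apply/subr_cvg0; exact: Fl.
    have := cvgM (cvgD (n0 (- `|Z x|)) (n0 `|Z x|)) (cvg_cst `|Z x|).
    by rewrite addr0 mul0r; exact.
  apply: (squeeze_cvgr _ (cvg_cst 0) lim0); apply: nearW => n /=.
  rewrite normr_ge0/=.
  have [c cZ ->] := primitive_increment (t n) (Z x) dH.
  rewrite -mulrBl normrM ler_wpM2r//.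
  move: cZ; rewrite ler_norml => /andP[c1 c2].
  have F1 : F (- `|Z x| + t n) <= F (c + t n) by apply: ndF; lra.
  have F2 : F (c + t n) <= F (`|Z x| + t n) by apply: ndF; lra.
  have := ler_norm (F (`|Z x| + t n) - l).
  have := ler_norm (- (F (- `|Z x| + t n) - l)); rewrite normrN.
  have := normr_ge0 (F (`|Z x| + t n) - l).
  have := normr_ge0 (F (- `|Z x| + t n) - l).
  rewrite ler_norml; lra.
- exact: integrable_CZ.
- apply: aeW => x Dx n; rewrite lee_fin; exact: increment_bound.
move=> cvgE; apply: fine_cvg; rewrite fineK//.
apply: integrable_fin_num => //.
by under eq_fun do rewrite EFinM; exact: integrableZl.
Qed.

(** Differentiation under the integral: as [F] takes values in [[0, C]], the derivative of the
    integrand is dominated by the constant [C]. *)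
Lemma is_derive_integral_increment (t : R) :
  is_derive t 1 (fun t => \int[mu]_(x in D) (H (t + Z x) - H t))
    (\int[mu]_(x in D) (F (t + Z x) - F t)).
Proof.
have dI (x : T) (s : R) :
    is_derive s 1 (fun t => H (t + Z x) - H t) (F (s + Z x) - F s).
  exact: is_derive_increment.
have It : `]t - 1, t + 1[%classic t by rewrite /= in_itv/=; lra.
have int_f s : `]t - 1, t + 1[%classic s ->
    mu.-integrable D (EFin \o (fun x => H (s + Z x) - H s)).
  by move=> _; exact: integrable_increment.
have der_f s x : `]t - 1, t + 1[%classic s -> D x ->
    derivable (fun t => H (t + Z x) - H t) s 1.
  by move=> _ _; case: (dI x s).
have C0 : 0 <= C by have := F0C 0; lra.
have iC : mu.-integrable D (EFin \o cst C).
  apply: (@integrable_bounded _ C); first exact: measurable_cst.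
  by move=> x _; rewrite /= ger0_norm.
have bnd s x : `]t - 1, t + 1[%classic s -> D x ->
    `|partial1of2 (fun t x => H (t + Z x) - H t) s x| <= cst C x.
  move=> _ _; rewrite partial1of2E; have [_ ->] := dI x s.
  by have := F0C (s + Z x); have := F0C s; rewrite /= ler_norml; lra.
apply: DeriveDef.
  exact: (derivable_under_integral mD It int_f der_f (fun=> C0) iC bnd).
rewrite -derive1E.
rewrite (differentiation_under_integral mD It int_f der_f (fun=> C0) iC bnd).
apply: eq_Rintegral => x _; rewrite partial1of2E.
by case: (dI x t).
Qed.

End increment.
End random_walk.

(** * Liouville property for bounded monotone functions under nonpositive drift *)

Section subharmonic.
Context (R : realType) (d : measure_display) (T : measurableType d)
  (mu : {measure set T -> \bar R}) (D : set T) (Z : T -> R).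
Hypotheses (mD : measurable D) (muD : mu D = 1%E).
Hypothesis iZ : mu.-integrable D (EFin \o Z).
Hypothesis Z0 : \int[mu]_(x in D) Z x <= 0.

(** [Phi] is nondecreasing, so it lies between its limits [0] at [-oo] and [sup F] times the mean of
    [Z], which is nonpositive, at [+oo]. Hence it vanishes, and so does its derivative. *)
Lemma bounded_subinvariant_invariant (F : R -> R) (C : R) :
  continuous F -> {homo F : s t / s <= t} -> (forall t, 0 <= F t <= C) ->
  (forall e : R, 0 < e -> exists t, F t <= e) ->
  (forall t, 0 <= \int[mu]_(x in D) (F (t + Z x) - F t)) ->
  forall t, \int[mu]_(x in D) (F (t + Z x) - F t) = 0.
Proof.
move=> cF ndF F0C FNy subF.
have [H dH] := continuous_primitive cF.
pose Phi t := \int[mu]_(x in D) (H (t + Z x) - H t).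
have dPhi (t : R) : is_derive t 1 Phi (\int[mu]_(x in D) (F (t + Z x) - F t)).
  exact: (is_derive_integral_increment mD muD iZ dH F0C).
have ndPhi s t : s <= t -> Phi s <= Phi t.
  rewrite le_eqVlt => /predU1P[->//|st].
  have [c _ E] := is_derive1_MVT dPhi st.
  by rewrite -subr_ge0 E mulr_ge0// subr_ge0 ltW.
have FNy0 c : F (c + - n%:R) @[n --> \oo] --> 0.
  apply/cvgrPdist_le => e e0; have [s Fs] := FNy e e0.
  near=> n; rewrite sub0r normrN ger0_norm; last by case/andP: (F0C (c + - n%:R)).
  apply: le_trans Fs; apply: ndF; rewrite lerBlDr -lerBlDl.
  by near: n; exact: nbhs_infty_ger.
have ubF : has_ubound (range F).
  by exists C => _ [s _ <-]; case/andP: (F0C s).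
have Fy c : F (c + n%:R) @[n --> \oo] --> sup (range F).
  apply: (cvg_comp _ _ _ (nondecreasing_cvgr ndF ubF)).
  exact: (cvg_comp _ _ cvgr_idn (cvg_addrl c)).
have sup0 : 0 <= sup (range F).
  have /andP[F0 _] := F0C 0.
  by rewrite (le_trans F0)//; apply: ub_le_sup => //; exists 0.
have Phi0 t : Phi t = 0.
  apply/eqP; rewrite eq_le; apply/andP; split.
    apply: (@le_trans _ _ (sup (range F) * \int[mu]_(x in D) Z x)); last first.
      by rewrite mulr_ge0_le0.
    have cPhi := cvg_integral_increment mD iZ dH F0C ndF Fy.
    apply: ler_cvg_to (cvg_cst (Phi t)) cPhi _.
    near=> n; apply: ndPhi; near: n; exact: nbhs_infty_ger.
  have := cvg_integral_increment mD iZ dH F0C ndF FNy0; rewrite mul0r => cPhi.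
  apply: ler_cvg_to cPhi (cvg_cst (Phi t)) _.
  near=> n; apply: ndPhi; rewrite lerNl.
  by near: n; exact: nbhs_infty_ger.
move=> t; have [_ <-] := dPhi t.
have -> : Phi = cst 0 by apply/funext => s; exact: Phi0.
exact: derive_cst.
Unshelve. all: end_near. Qed.

(** Strict convexity of the square gains the variance-like term [S]; invariance of the mean of [G^2]
    forces it to vanish, which makes [z] a period of [G]. *)
Lemma bounded_subharmonic_eq0 (G : R -> R) (C z : R) :
  continuous G -> {homo G : s t / s <= t} -> (forall t, 0 <= G t <= C) ->
  (forall e : R, 0 < e -> exists t, G t <= e) ->
  z < 0 -> (0 < mu (D `&` [set x | Z x <= z]%R))%E ->
  (forall t, G t <= \int[mu]_(x in D) G (t + Z x)) ->
  forall t, G t = 0.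
Proof.
move=> cG ndG G0C GNy z0 muz subG.
have mZ : measurable_fun D Z by apply/measurable_EFinP/(measurable_int mu).
pose E := D `&` [set x | Z x <= z].
have mE : measurable E.
  have -> : E = D `&` Z @^-1` `]-oo, z].
    by apply/seteqP; split => x /=; rewrite in_itv.
  by apply: mZ.
have muE1 : (mu E <= 1)%E.
  by rewrite -muD; apply: le_measure; rewrite ?inE//; exact: subIsetl.
have muEfin : mu E \is a fin_num.
  by rewrite ge0_fin_numE// (le_lt_trans muE1)// ltry.
have p0 : 0 < fine (mu E) by rewrite fine_gt0// muz -ge0_fin_numE.
have mG t := measurable_comp_increment iZ t cG.
have iG t : mu.-integrable D (EFin \o (fun x => G (t + Z x))).
  apply: (integrable_bounded mD muD (mG t) (C := C)) => x _.
  by have /andP[? ?] := G0C (t + Z x); rewrite ger0_norm.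
have C0 : 0 <= C by have := G0C 0; lra.
pose F t := G t ^+ 2.
pose S t x := (G (t + Z x) - G t) ^+ 2.
have mS t : measurable_fun D (S t).
  apply: measurable_funX.
  exact: (measurable_funB (mG t) (measurable_cst _)).
have iS t : mu.-integrable D (EFin \o S t).
  apply: (integrable_bounded mD muD (mS t) (C := C ^+ 2)) => x _.
  rewrite ger0_norm ?sqr_ge0// -[leLHS]real_normK ?num_real//.
  rewrite ler_pXn2r ?nnegrE//.
  by have := G0C t; have := G0C (t + Z x); rewrite ler_norml; lra.
(* From [b^2 - a^2 = (b - a)^2 + 2 a (b - a)]; both resulting terms are nonnegative, by [G >= 0] and
   [subG]. *)
have FE t : \int[mu]_(x in D) (F (t + Z x) - F t) =
    \int[mu]_(x in D) S t x + 2 * G t * (\int[mu]_(x in D) G (t + Z x) - G t).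
  have icst : mu.-integrable D (EFin \o cst (G t)).
    apply: (integrable_bounded mD muD (measurable_cst _) (C := G t)) => x _.
    by rewrite ger0_norm//; case/andP: (G0C t).
  have iB : mu.-integrable D (EFin \o (fun x => G (t + Z x) - G t)).
    by rewrite /comp; under eq_fun do rewrite EFinB;
      apply: (integrableB mD (iG t) icst).
  transitivity (\int[mu]_(x in D) (S t x + 2 * G t * (G (t + Z x) - G t))).
    by apply: eq_Rintegral => x _; rewrite /F /S; ring.
  rewrite RintegralD//; last first.
    by rewrite /comp; under eq_fun do rewrite EFinM; exact: integrableZl.
  by rewrite RintegralZl// RintegralB// Rintegral_cst// muD mulr1.
(* A Markov-type bound: on [E], monotonicity gives [G (t + Z x) <= G (t + z) <= G t]. *)
have SE t : (G t - G (t + z)) ^+ 2 * fine (mu E) <= \int[mu]_(x in D) S t x.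
  rewrite -lee_fin EFinM fineK// /Rintegral fineK; last first.
    exact: (integrable_fin_num mD (iS t)).
  rewrite -integral_cst//.
  have mSE : measurable_fun D (EFin \o S t) by exact/measurable_EFinP.
  apply: (@le_trans _ _ (\int[mu]_(x in E) (S t x)%:E)%E); last first.
    apply: ge0_subset_integral => //; last exact: subIsetl.
    by move=> x _; rewrite lee_fin sqr_ge0.
  apply: ge0_le_integral => //.
  - by move=> x _; rewrite lee_fin sqr_ge0.
  - by apply: measurable_funS mSE => //; exact: subIsetl.
  move=> x [_ /= xz]; rewrite lee_fin /S -(sqrrN (G (t + Z x) - _)) opprB.
  have G1 : G (t + Z x) <= G (t + z) by apply: ndG; lra.
  have G2 : G (t + z) <= G t by apply: ndG; lra.
  by rewrite ler_pXn2r// ?nnegrE; lra.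
have F0 : forall t, \int[mu]_(x in D) (F (t + Z x) - F t) = 0.
  apply: (@bounded_subinvariant_invariant F (C ^+ 2)).
  - by move=> t; apply: cvgM; exact: cG.
  - move=> s t st; rewrite /F ler_pXn2r ?nnegrE ?ndG//.
    + by case/andP: (G0C s).
    + by case/andP: (G0C t).
  - move=> t; have /andP[G0 GC] := G0C t.
    rewrite /F; apply/andP; split; first exact: sqr_ge0.
    by rewrite ler_pXn2r ?nnegrE.
  - move=> e e0; have [|t Gt] := GNy (Num.sqrt e); first by rewrite sqrtr_gt0.
    exists t; rewrite /F -[leRHS]sqr_sqrtr; last exact: ltW.
    rewrite ler_pXn2r ?nnegrE ?sqrtr_ge0//.
    by case/andP: (G0C t).
  - move=> t; rewrite FE addr_ge0//.
      by apply: Rintegral_ge0 => x _; exact: sqr_ge0.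
    by rewrite !mulr_ge0 ?subr_ge0//; case/andP: (G0C t).
have Gz t : G (t + z) = G t.
  have := SE t; have := F0 t; rewrite FE => E1 E2.
  have : 0 <= 2 * G t * (\int[mu]_(x in D) G (t + Z x) - G t).
    by rewrite !mulr_ge0 ?subr_ge0//; case/andP: (G0C t).
  move=> E3; have : (G t - G (t + z)) ^+ 2 * fine (mu E) <= 0 by lra.
  rewrite pmulr_lle0// => E4.
  have : (G t - G (t + z)) ^+ 2 == 0 by rewrite eq_le E4 sqr_ge0.
  by rewrite sqrf_eq0 subr_eq0 => /eqP.
have Gzn t n : G (t + z *+ n) = G t.
  elim: n => [|n IH]; first by rewrite mulr0n addr0.
  by rewrite mulrSr addrA Gz.
move=> t; apply/eqP; rewrite eq_le; have /andP[-> _] := G0C t; rewrite andbT.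
apply/ler_addgt0Pr => e e0; rewrite add0r.
have [s Gs] := GNy e e0; apply: le_trans Gs.
(* This many periods move [t] below [s]; if [t < s], a single one is taken. *)
rewrite -(Gzn t (Num.truncn ((t - s) / - z)).+1); apply: ndG.
have := truncnS_gt ((t - s) / - z).
rewrite ltr_pdivrMr; last lra.
rewrite -mulr_natr; lra.
Qed.
End subharmonic.

(** * The oscillation of a bounded Lipschitz function *)

(** The global modulus of continuity of [y]. For [h < 0] the set is empty and [sup] takes its
    default value, so the lemmas work with [0 <= h]. *)
Definition oscillation (R : realType) (y : R -> R) (h : R) : R :=
  sup [set r | exists x k, `|k| <= h /\ r = `|y (x + k) - y x|].

Section oscillation.
Context (R : realType) (y : R -> R) (M L : R).
Hypothesis yM : forall x, `|y x| <= M.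
Hypothesis yL : forall x x', `|y x' - y x| <= L * `|x' - x|.

Lemma oscillation_ub (x k h : R) : `|k| <= h ->
  `|y (x + k) - y x| <= oscillation y h.
Proof.
move=> kh; apply: ub_le_sup; last by exists x, k.
exists (2 * M) => _ [z [l [_ ->]]].
by have := yM (z + l); have := yM z; rewrite !ler_norml; lra.
Qed.

Lemma oscillation_le (h B : R) : 0 <= h ->
  (forall x k, `|k| <= h -> `|y (x + k) - y x| <= B) -> oscillation y h <= B.
Proof.
move=> h0 hB; apply: ge_sup.
  by exists `|y (0 + 0) - y 0|, 0, 0; rewrite normr0.
by move=> _ [x [k [kh ->]]]; exact: hB.
Qed.

Lemma oscillation_ge0 (h : R) : 0 <= h -> 0 <= oscillation y h.
Proof.
by move=> h0; apply: le_trans (@oscillation_ub 0 0 h _); rewrite ?normr0.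
Qed.

Lemma oscillation_le_bound (h : R) : 0 <= h -> oscillation y h <= 2 * M.
Proof.
move=> h0; apply: oscillation_le => // x k _.
by have := yM (x + k); have := yM x; rewrite !ler_norml; lra.
Qed.

Lemma oscillation_nd (h h' : R) : 0 <= h -> h <= h' ->
  oscillation y h <= oscillation y h'.
Proof.
move=> h0 hh'; apply: oscillation_le => // x k kh.
by apply: oscillation_ub; exact: le_trans hh'.
Qed.

Lemma lipschitz_const_ge0 : 0 <= L.
Proof.
have := yL 0 1; rewrite subr0 normr1 mulr1; exact: le_trans.
Qed.

Lemma oscillation_lipschitz (h h' : R) : 0 <= h -> h <= h' ->
  oscillation y h' <= oscillation y h + L * (h' - h).
Proof.
move=> h0 hh'; apply: oscillation_le; first exact: le_trans hh'.
move=> x k kh'; have L0 := lipschitz_const_ge0.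
(* Truncating [k] to [[-h, h]] leaves a remainder of size at most [h' - h], which the Lipschitz
   bound handles. *)
pose l := Num.max (- h) (Num.min k h).
have [lh lk] : `|l| <= h /\ `|k - l| <= h' - h.
  move: kh'; rewrite /l /Num.max /Num.min !ler_norml => /andP[? ?].
  by case: ifPn; rewrite -?leNgt; case: ifPn; rewrite -?leNgt; lra.
have -> : y (x + k) - y x = y (x + l) - y x + (y (x + k) - y (x + l)) by ring.
apply: (le_trans (ler_normD _ _)); apply: lerD; first exact: oscillation_ub.
apply: (le_trans (yL _ _)); apply: ler_wpM2l => //.
by have -> : x + k - (x + l) = k - l by ring.
Qed.

Lemma continuous_oscillation_expR :
  continuous (fun t => oscillation y (expR t)).
Proof.
have lip s t : s <= t -> `|oscillation y (expR s) - oscillation y (expR t)| <=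
    L * `|expR s - expR t|.
  move=> st; have est : expR s <= expR t by rewrite ler_expR.
  have := oscillation_nd (expR_ge0 s) est.
  have := oscillation_lipschitz (expR_ge0 s) est.
  rewrite (distrC (expR s)) (@ger0_norm _ (_ - expR s)) ?subr_ge0//.
  rewrite ler_norml; lra.
move=> t; apply/subr_cvg0; apply: norm_cvg0.
have lim0 : L * `|expR s - expR t| @[s --> t] --> (0 : R).
  have e0 : expR s - expR t @[s --> t] --> (0 : R).
    by apply/subr_cvg0; exact: continuous_expR.
  by have := cvgM (cvg_cst L) (cvg_norm e0); rewrite normr0 mulr0; exact.
apply: (squeeze_cvgr _ (cvg_cst 0) lim0); apply: nearW => s /=.
rewrite normr_ge0/=; have [st|/ltW ts] := leP s t; first exact: lip.
by rewrite distrC (distrC (expR s)); exact: lip.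
Qed.

Lemma oscillation_expR_small (e : R) : 0 < e ->
  exists t, oscillation y (expR t) <= e.
Proof.
move=> e0; have L0 := lipschitz_const_ge0.
(* At scale [h = e / (L + 1)] the oscillation is at most [L * h <= e]; the [+ 1] covers [L = 0]. *)
exists (ln (e / (L + 1))); rewrite lnK; last by rewrite posrE divr_gt0//; lra.
have := @oscillation_lipschitz 0 (e / (L + 1)) (lexx _) _.
rewrite subr0 => /(_ _)/wrap[]; first by rewrite divr_ge0//; lra.
move=> H; apply: (le_trans H).
rewrite -[leRHS]add0r lerD//; last by rewrite mulrA ler_pdivrMr; nra.
apply: oscillation_le => // x k; rewrite normr_le0 => /eqP ->.
by rewrite addr0 subrr normr0.
Qed.

End oscillation.

(** * From the equation to the vanishing of the oscillation *)

(** Otherwise [Z >= 0] almost everywhere, because [Z < 0] is the countable union of the events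
    [Z <= - 1 / (n + 1)]. Then [Z] and [|Z|] have the same integral, which must be [0]. *)
Lemma exists_negative_values (R : realType) (d : measure_display)
    (T : measurableType d) (mu : {measure set T -> \bar R}) (D : set T)
    (Z : T -> R) :
  measurable D -> measurable_fun D Z ->
  (\int[mu]_(x in D) (Z x)%:E <= 0)%E ->
  (\int[mu]_(x in D) `|Z x|%:E <> 0)%E ->
  exists2 z : R, z < 0 & (0 < mu (D `&` [set x | Z x <= z]%R))%E.
Proof.
move=> mD mZ Z0 absZ; apply: contrapT => noz.
have mE z : measurable (D `&` [set x | Z x <= z]).
  have -> : D `&` [set x | Z x <= z] = D `&` Z @^-1` `]-oo, z].
    by apply/seteqP; split => x /=; rewrite in_itv.
  by apply: mZ.
have muE (z : R) : z < 0 -> mu (D `&` [set x | Z x <= z]) = 0%E.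
  move=> z0; apply/eqP; rewrite eq_le measure_ge0 andbT leNgt.
  by apply/negP => zE; apply: noz; exists z.
have ZN : mu.-negligible (D `&` [set x | Z x < 0]).
  apply: (@negligibleS _ _ _ _
      (\bigcup_n (D `&` [set x | Z x <= - n.+1%:R^-1]))).
    move=> x [Dx /= Zx0].
    have /ltr_add_invr[n] : 0 < - Z x by rewrite oppr_gt0.
    by rewrite add0r => nZ; exists n => //; split => //; rewrite /= lerNr ltW.
  apply: negligible_bigcup => n; apply/negligibleP => //.
  by apply: muE; rewrite oppr_lt0.
have Zae : ae_eq mu D (fun x => (Z x)%:E) (fun x => `|Z x|%:E).
  apply: negligibleS ZN => x /= /not_implyP[Dx nZ]; split => //.
  by rewrite ltNge; apply/negP => Z0x; apply: nZ; rewrite ger0_norm.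
apply: absZ; apply/eqP; rewrite eq_le integral_ge0// andbT.
suff <- : (\int[mu]_(x in D) (Z x)%:E = \int[mu]_(x in D) `|Z x|%:E)%E by [].
apply: ae_eq_integral => //; first exact/measurable_EFinP.
by apply/measurable_EFinP; exact: measurableT_comp.
Qed.

(** By linearity each increment of [y] solves the equation with an averaged increment on the right,
    so the maximum principle applies to it. *)
Lemma oscillation_subharmonic (R : realType) (a1 a2 M L : R)
    (mu : {measure set measurableTypeR R -> \bar R}) (y y1 y2 : R -> R) :
  0 <= a1 -> 0 <= a2 -> (mu `]0%R, +oo[%classic = 1)%E ->
  (forall x : R, is_derive x 1 y (y1 x)) ->
  (a2 != 0 -> forall x : R, is_derive x 1 y1 (y2 x)) ->
  (forall x, `|y x| <= M) -> (forall x x', `|y x' - y x| <= L * `|x' - x|) ->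
  (forall x, - a2 * y2 x + a1 * y1 x + y x =
     \int[mu]_(a in `]0%R, +oo[) y (a * x)) ->
  forall t, oscillation y (expR t) <=
    \int[mu]_(a in `]0%R, +oo[) oscillation y (expR (t + ln a)).
Proof.
move=> a10 a20 mu1 yd y1d yM yL eqn t.
have mD : measurable (`]0%R, +oo[%classic : set (measurableTypeR R)).
  exact: measurable_itv.
have cy : continuous y := is_derive1_continuous yd.
have iy x : mu.-integrable `]0%R, +oo[ (EFin \o (fun a => y (a * x))).
  apply: (integrable_bounded mD mu1 (C := M)) => //.
  apply: measurable_funTS; apply: (@measurableT_comp _ _ _ _ _ _ y).
    exact: continuous_measurable_fun.
  by apply: measurable_funM => //; exact: measurable_cst.
have iG : mu.-integrable `]0%R, +oo[
    (EFin \o (fun a => oscillation y (expR (t + ln a)))).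
  apply: (integrable_bounded mD mu1 (C := 2 * M)) => //.
    apply: measurable_funTS.
    apply: (@measurableT_comp _ _ _ _ _ _ (fun s => oscillation y (expR s))).
      exact: (continuous_measurable_fun (continuous_oscillation_expR yM yL)).
    by apply: measurable_funD; [exact: measurable_cst|exact: measurable_ln].
  move=> a _; rewrite ger0_norm.
    exact: (oscillation_le_bound yM (expR_ge0 _)).
  exact: (oscillation_ge0 yM (expR_ge0 _)).
set I := Rintegral _ _ _.
have upper x k : `|k| <= expR t -> y (x + k) - y x <= I.
  move=> kt; pose u s := y (s + k) - y s.
  apply: (@maximum_principle _ a1 a2 (2 * M) I u
    (fun s => y1 (s + k) - y1 s) (fun s => y2 (s + k) - y2 s)) => //.
  - by move=> s; exact: is_derive_increment.
  - by move=> /y1d y1d' s; exact: is_derive_increment.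
  - by move=> s; have := yM (s + k); have := yM s; rewrite /u !ler_norml; lra.
  move=> s.
  have -> : - a2 * (y2 (s + k) - y2 s) + a1 * (y1 (s + k) - y1 s) + u s =
    (- a2 * y2 (s + k) + a1 * y1 (s + k) + y (s + k)) -
    (- a2 * y2 s + a1 * y1 s + y s) by rewrite /u; ring.
  have iB : mu.-integrable `]0%R, +oo[
      (EFin \o (fun a => y (a * (s + k)) - y (a * s))).
    exact: (integrableB mD (iy (s + k)) (iy s)).
  rewrite !eqn -RintegralB//; apply: le_Rintegral => //.
  move=> a; rewrite /= in_itv/= andbT => a0.
  apply: (le_trans (ler_norm _)).
  rewrite mulrDr; apply: (oscillation_ub yM).
  (* Dilation by [a] scales the increment: [|a k| <= a e^t = e^(t + ln a)]. *)
  by rewrite expRD lnK// normrM gtr0_norm// mulrC ler_wpM2r// ltW.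
apply: oscillation_le; first exact: expR_ge0.
move=> x k kt; rewrite ler_norml upper// andbT.
(* Exchanging the two endpoints turns the upper bound into the lower one. *)
have := upper (x + k) (- k); rewrite normrN addrK => /(_ kt); lra.
Qed.

Theorem theorem1 (R : realType) (a1 a2 : R)
    (ha1 : 0 <= a1) (ha2 : 0 <= a2) (ha : 0 < a1 ^+ 2 + a2 ^+ 2)
    (mu : probability (measurableTypeR R) R)
    (hmu : mu `]0, +oo[%classic = 1%E)
    (d : measure_display) (Omega : measurableType d) (P : probability Omega R)
    (alpha : {RV P >-> measurableTypeR R})
    (halpha : forall A : set (measurableTypeR R), measurable A ->
       distribution P alpha A = mu A)
    (hln0 : ('E_P[fun w => `|ln (alpha w : R)|%R] <> 0)%E)
    (hlnfin : ('E_P[fun w => `|ln (alpha w : R)|%R] < +oo)%E)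
    (hK : (\int[mu]_(a in `]0%R, +oo[) (ln (a : R))%:E <= 0)%E)
    (y : R -> R) (hy : bounded_solution a1 a2 mu y) :
  exists c : R, forall x : R, y x = c.
Proof.
case: hy => -[M [_ My]] [dy ddy eqn].
(* Boundedness is given as a bound by every number greater than [M]. *)
have {My} yM x : `|y x| <= M + 1 by apply: My => //; rewrite ltrDl.
have yd (x : R) : is_derive x 1 y ((y^`())%classic x).
  by apply: DeriveDef; rewrite ?derive1E.
have y1d (a2N0 : a2 != 0) (x : R) :
    is_derive x 1 ((y^`())%classic) ((y^`(2))%classic x).
  by apply: DeriveDef; [exact: ddy|rewrite derive1nS derive1n1 derive1E].
have mD : measurable (`]0%R, +oo[%classic : set (measurableTypeR R)).
  exact: measurable_itv.
have eqnR x : - a2 * (y^`(2))%classic x + a1 * ((y^`())%classic) x + y x =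
    \int[mu]_(a in `]0%R, +oo[) y (a * x) by rewrite /Rintegral -eqn.
have cy : continuous y := is_derive1_continuous yd.
have iy x : mu.-integrable `]0%R, +oo[ (EFin \o (fun a => y (a * x))).
  apply: (integrable_bounded mD hmu (C := M + 1)) => //.
  apply: measurable_funTS; apply: (@measurableT_comp _ _ _ _ _ _ y).
    exact: continuous_measurable_fun.
  by apply: measurable_funM => //; exact: measurable_cst.
have [L y1L] : exists L, forall x, `|(y^`())%classic x| <= L.
  apply: (bounded_derivative ha1 ha2 ha yd y1d yM) => x.
  rewrite eqnR (le_trans (le_normr_Rintegral mD (iy x)))//.
  have icst : mu.-integrable `]0%R, +oo[ (EFin \o cst (M + 1)).
    apply: (integrable_bounded mD hmu (measurable_cst _) (C := M + 1)) => a _.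
    by rewrite ger0_norm// (le_trans (normr_ge0 (y 0))).
  have -> : M + 1 = \int[mu]_(a in `]0%R, +oo[) (M + 1).
    by rewrite Rintegral_cst// [fine _](congr1 fine hmu) mulr1.
  by apply: le_Rintegral => //; exact: (integrable_norm (iy x)).
have yL x x' : `|y x' - y x| <= L * `|x' - x|.
  have [c _ E] := primitive_increment x (x' - x) yd.
  move: E; rewrite addrCA subrr addr0 => ->.
  by rewrite normrM ler_wpM2r.
(* The expectation is carried to the law [mu] on the whole line; there [ln] is [0] on nonpositive
   numbers by convention, so only []0, +oo[] contributes. *)
have absln : ('E_P[fun w => `|ln (alpha w : R)|%R] =
    \int[mu]_(a in `]0%R, +oo[) `|ln (a : R)|%:E)%E.
  have mabs : measurable_fun [set: measurableTypeR R]
      (EFin \o (fun a : measurableTypeR R => `|ln (a : R)|)).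
    apply/measurable_EFinP.
    by apply: (@measurableT_comp _ _ _ _ _ _ (@Num.norm R R)) => //;
      exact: measurable_ln.
  rewrite unlock.
  have := @ge0_integral_distribution _ _ _ _ _ P alpha
    _ mabs (fun a => normr_ge0 _) => /= <-.
  rewrite (eq_measure_integral mu); last by move=> A mA _; exact: halpha.
  rewrite [RHS]integral_mkcond; apply: eq_integral => a _.
  rewrite patchE; case: ifPn => //; rewrite notin_setE/= in_itv/= andbT.
  by move=> /negP; rewrite -leNgt => a0; rewrite ln0// normr0.
rewrite absln in hln0 hlnfin.
have mln : measurable_fun (`]0%R, +oo[%classic : set (measurableTypeR R)) (@ln R).
  by apply: measurable_funTS; exact: measurable_ln.
have iln : mu.-integrable `]0%R, +oo[ (EFin \o @ln R).
  apply/integrableP; split; first exact/measurable_EFinP.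
  exact: hlnfin.
have [z z0 muz] := exists_negative_values mD mln hK hln0.
have ln_le0 : \int[mu]_(a in `]0%R, +oo[) ln a <= 0 by exact: fine_le0.
have osc0 t : oscillation y (expR t) = 0.
  apply: (bounded_subharmonic_eq0 mD hmu iln ln_le0
    (continuous_oscillation_expR yM yL) _ _ _ z0 muz) => //.
  - by move=> s s' ss'; apply: (oscillation_nd yM); rewrite ?expR_ge0 ?ler_expR.
  - move=> s; rewrite (oscillation_ge0 yM) ?expR_ge0//.
    exact: (oscillation_le_bound yM (expR_ge0 s)).
  - by move=> e; exact: (oscillation_expR_small yM yL).
  - exact: (oscillation_subharmonic ha1 ha2 hmu yd y1d yM yL eqnR).
(* A point [x != 0] is compared with [0] at scale [|x| = e^(ln |x|)]; the point [0] is separate,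
   since the exponential never vanishes. *)
exists (y 0) => x.
have [->//|x0] := eqVneq x 0.
have := @oscillation_ub _ _ _ yM 0 x (expR (ln `|x|)).
rewrite osc0 add0r lnK ?posrE ?normr_gt0// => /(_ (lexx _)).
by rewrite normr_le0 subr_eq0 => /eqP.
Qed.
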